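(* Let $\Sigma$ be a Riemann surface and $X:\Sigma\to\mathbb{R}^3$ an immersion with Gauss map $N$ such that $\langle X(p),N(p)\rangle\neq1$ for all $p\in\Sigma$, locally parameterized, as described in the context, by $$X=Y-\frac{2(h+c)}{S}\,\eta$$ with $Y=\pi_-^{-1}\circ g$, $g$ holomorphic, $c$ a nonzero real constant and $h:U\subset\mathbb{R}^2\to\mathbb{R}$ the associated differentiable function. Then: (1) $\Sigma$ is an $H_1$-surface if and only if $h$ satisfies the Helmholtz equation $$\Delta h+\frac{8|g'|^2}{T^2}\,h=0,\qquad T=1+|g|^2;$$ (2) $\Sigma$ is an $H_2$-surface if and only if $h$ satisfies the generalized Helmholtz equation $$\Delta\left[\frac{1}{\left(\frac{4|g'|^2}{T^2}\right)}\left(\Delta h+\frac{8|g'|^2}{T^2}\,h\right)\right]=0,\qquad T=1+|g|^2,$$ where in both cases $g$ is a holomorphic function such that $g'\neq0$, and $\Delta$ is the Euclidean Laplacian in $\mathbb{R}^2$.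
   Context: Setting. Identify $\mathbb{R}^2=\mathbb{C}$ and $\mathbb{R}^3=\mathbb{C}\times\mathbb{R}$. Let $g:\mathbb{C}\to\mathbb{C}_\infty$ be holomorphic with $g'\neq0$, let $\pi_-^{-1}:\mathbb{C}\to\mathbb{S}^2\setminus\{-e_3\}$ be the inverse of stereographic projection, let $U\subset\mathbb{R}^2$ be open, $T=1+|g|^2$, and $Y=\pi_-^{-1}\circ g=\frac1T(2g,\,2-T):U\to\mathbb{S}^2$. Then $L_{ij}=\langle Y_{,i},Y_{,j}\rangle=\frac{4|g'|^2}{T^2}\delta_{ij}$. An immersion $X:\Sigma\to\mathbb{R}^3$ with $\langle X,N\rangle\neq1$ everywhere can be locally parameterized by $X=Y-\frac{2(h+c)}{S}\eta$, where $c$ is a nonzero real constant, $h:U\to\mathbb{R}$ is a nowhere-vanishing differentiable function, and $$\eta=\nabla_Lh+hY,\qquad \nabla_L h=\frac{T^2}{4|g'|^2}(h_{,1}Y_{,1}+h_{,2}Y_{,2}),\qquad S=\langle\eta,\eta\rangle=|\nabla_Lh|^2+h^2;$$ in these coordinates the Gauss map is $N=Y-\frac{2h}{S}\eta$. Curvatures. Let $\Psi=\langle X,N\rangle$ (support function), $R=\frac{1-|X|^2}{2(\Psi-1)}$ (radius function of the sphere congruence having $\Sigma$ and the unit sphere as envelopes; one has $h=-\frac{c}{R+1}$), let $k_1,k_2$ be the principal curvatures (eigenvalues of $-dN$), $s_i=\frac{1+k_i}{1-k_iR}$, and $H_S=\frac12(s_1+s_2)$ (spherical mean curvature). $\Sigma$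 is an $H_1$-surface if $H_S=0$. $\Sigma$ is an $H_2$-surface if $\Delta_\sigma\left[\frac{H_S}{\Psi-1}\right]=0$, where $\sigma=I+2R\,II+R^2\,III$ and $I,II,III$ are the fundamental forms of $\Sigma$: $I=\langle dX,dX\rangle$, $II=\langle -dN,dX\rangle$, $III=\langle dN,dN\rangle$.
   Formalization: With II = <-dN,dX>, part (2) fails for sigma = I + 2R II + R^2 III (e.g. g(z)=z, h=x, c=1 near small x>0); the formal statement uses sigma = I - 2R II + R^2 III, i.e. the opposite sign convention for II in sigma. *)

(* Defs.v *)
From Stdlib Require Import Reals.
From Coquelicot Require Import Coquelicot.

Open Scope R_scope.

(* Coquelicot's [C] is by definition [R * R], so it serves both as the complex
   numbers and as the Euclidean plane; tangent vectors of the plane are also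
   elements of [C].  On [R3 = (R * R) * R] we use the vector operations [plus],
   [minus], [opp], [scal] that Coquelicot derives from the product structure. *)
Definition R3 : Type := (R * R * R)%type.

Definition dot (x y : R3) : R :=
  fst (fst x) * fst (fst y) + snd (fst x) * snd (fst y) + snd x * snd y.

(* [Derive] is total (junk where the derivative does not exist). *)
Definition d1 (f : C -> R) (z : C) : R := Derive (fun x => f (x, snd z)) (fst z).
Definition d2 (f : C -> R) (z : C) : R := Derive (fun y => f (fst z, y)) (snd z).

Definition laplacian (f : C -> R) (z : C) : R := d1 (d1 f) z + d2 (d2 f) z.

Fixpoint class_C (k : nat) (U : C -> Prop) (f : C -> R) : Prop :=
  (forall z, U z -> continuous f z) /\
  match k with
  | O => True
  | S k' =>
      (forall z, U z -> ex_derive (fun x => f (x, snd z)) (fst z) /\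
                        ex_derive (fun y => f (fst z, y)) (snd z)) /\
      class_C k' U (d1 f) /\ class_C k' U (d2 f)
  end.

Definition smooth (U : C -> Prop) (f : C -> R) : Prop := forall k, class_C k U f.

Definition smooth3 (U : C -> Prop) (F : C -> R3) : Prop :=
  smooth U (fun z => fst (fst (F z))) /\
  smooth U (fun z => snd (fst (F z))) /\
  smooth U (fun z => snd (F z)).

Definition D1 (F : C -> R3) (z : C) : R3 :=
  (d1 (fun w => fst (fst (F w))) z, d1 (fun w => snd (fst (F w))) z,
   d1 (fun w => snd (F w)) z).
Definition D2 (F : C -> R3) (z : C) : R3 :=
  (d2 (fun w => fst (fst (F w))) z, d2 (fun w => snd (fst (F w))) z,
   d2 (fun w => snd (F w)) z).

Definition differential (F : C -> R3) (z v : C) : R3 :=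
  plus (scal (fst v) (D1 F z)) (scal (snd v) (D2 F z)).

Definition holomorphic_on (U : C -> Prop) (g : C -> C) : Prop :=
  forall z, U z -> ex_derive (K := C_AbsRing) (V := C_NormedModule) g z.

(* A Riemann surface given by local parametrizations [par a : dom a -> points],
   the inverses of holomorphic charts.  The topology is not a separate datum: it
   is the one for which the [par a] are homeomorphisms onto open sets, and
   [rs_hausdorff] is separation in that topology.  Functions out of [C] are
   total, but only the values of [par a] on [dom a] matter. *)
Record RiemannSurface := {
  points :> Type;
  chart : Type;
  dom : chart -> C -> Prop;
  par : chart -> C -> points;
  dom_open : forall a, open (dom a);
  par_inj : forall a z w, dom a z -> dom a w -> par a z = par a w -> z = w;
  par_cover : forall p, exists a z, dom a z /\ par a z = p;
  overlap_open : forall a b,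
    open (fun z : C => dom a z /\ exists w, dom b w /\ par b w = par a z);
  transition_holomorphic : forall a b (tau : C -> C),
    let W := fun z : C => dom a z /\ exists w, dom b w /\ par b w = par a z in
    (forall z, W z -> dom b (tau z) /\ par b (tau z) = par a z) ->
    holomorphic_on W tau;
  rs_hausdorff : forall p q : points, p <> q ->
    exists a b (V W : C -> Prop),
      open V /\ open W /\
      (forall z, V z -> dom a z) /\ (forall z, W z -> dom b z) /\
      (exists z, V z /\ par a z = p) /\ (exists w, W w /\ par b w = q) /\
      (forall z w, V z -> W w -> par a z <> par b w)
}.

Arguments chart : clear implicits.
Arguments dom {_} _ _.
Arguments par {_} _ _.

Definition pull {Sigma : RiemannSurface} {A : Type} (f : Sigma -> A)
  (a : chart Sigma) : C -> A := fun z => f (par a z).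

Section Surface.

Context {Sigma : RiemannSurface}.
Variables X N : Sigma -> R3.

Definition immersion : Prop :=
  forall a, smooth3 (dom a) (pull X a) /\
    forall z, dom a z -> forall v : C,
      differential (pull X a) z v = zero -> v = RtoC 0.

Definition gauss_map : Prop :=
  forall a, smooth3 (dom a) (pull N a) /\
    forall z, dom a z ->
      dot (pull N a z) (pull N a z) = 1 /\
      forall v : C, dot (pull N a z) (differential (pull X a) z v) = 0.

(* [k1 p], [k2 p] are the eigenvalues, with multiplicity, of the self-adjoint
   map -dN, its tangent plane being identified with C by dX: there is a basis
   [v], [w] of eigenvectors. *)
Definition principal_curvatures (k1 k2 : Sigma -> R) : Prop :=
  forall a z, dom a z ->
    exists v w : C,
      fst v * snd w - snd v * fst w <> 0 /\
      opp (differential (pull N a) z v)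
        = scal (k1 (par a z)) (differential (pull X a) z v) /\
      opp (differential (pull N a) z w)
        = scal (k2 (par a z)) (differential (pull X a) z w).

Definition support (p : Sigma) : R := dot (X p) (N p).

Definition radius (p : Sigma) : R := (1 - dot (X p) (X p)) / (2 * (support p - 1)).

Definition spherical_mean (k1 k2 : Sigma -> R) (p : Sigma) : R :=
  ((1 + k1 p) / (1 - k1 p * radius p) + (1 + k2 p) / (1 - k2 p * radius p)) / 2.

Definition first_form (a : chart Sigma) (z v w : C) : R :=
  dot (differential (pull X a) z v) (differential (pull X a) z w).
Definition second_form (a : chart Sigma) (z v w : C) : R :=
  dot (opp (differential (pull N a) z v)) (differential (pull X a) z w).
Definition third_form (a : chart Sigma) (z v w : C) : R :=
  dot (differential (pull N a) z v) (differential (pull N a) z w).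

(* The sign of the middle term goes with II = <-dN, dX>: this sigma is
   <dX + R dN, dX + R dN>, with eigenvalues (1 - k_i R)^2 relative to I, the
   squares of the denominators in [spherical_mean].  It is I + 2R II + R^2 III
   for the opposite convention II = <dN, dX>. *)
Definition sigma (a : chart Sigma) (z v w : C) : R :=
  first_form a z v w - 2 * pull radius a z * second_form a z v w
  + pull radius a z ^ 2 * third_form a z v w.

End Surface.

(* div grad f for the metric E dx^2 + 2 F dx dy + G dy^2. *)
Definition laplace_beltrami (E F G f : C -> R) (z : C) : R :=
  let r := fun w => sqrt (E w * G w - F w ^ 2) in
  (d1 (fun w => (G w * d1 f w - F w * d2 f w) / r w) z
   + d2 (fun w => (E w * d2 f w - F w * d1 f w) / r w) z) / r z.

Definition e1 : C := (1, 0).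
Definition e2 : C := (0, 1).

Definition H1_surface {Sigma : RiemannSurface} (X N : Sigma -> R3)
  (k1 k2 : Sigma -> R) : Prop :=
  forall p, spherical_mean X N k1 k2 p = 0.

Definition H2_surface {Sigma : RiemannSurface} (X N : Sigma -> R3)
  (k1 k2 : Sigma -> R) : Prop :=
  forall a z, dom a z ->
    laplace_beltrami
      (fun w => sigma X N a w e1 e1) (fun w => sigma X N a w e1 e2)
      (fun w => sigma X N a w e2 e2)
      (pull (fun p => spherical_mean X N k1 k2 p / (support X N p - 1)) a) z = 0.

Section Parametrization.

Variables (g : C -> C) (h : C -> R).

(* [Y] is g followed by the inverse of stereographic projection from -e_3; the
   formula needs finite values of g, so [g] is C-valued. *)
Definition T (z : C) : R := 1 + Cmod (g z) ^ 2.

Definition Y (z : C) : R3 :=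
  (2 * Re (g z) / T z, 2 * Im (g z) / T z, (2 - T z) / T z).

(* Gradient of h for the metric <Y_i, Y_j> = (4 |g'|^2 / T^2) delta_ij. *)
Definition grad_L (z : C) : R3 :=
  scal (T z ^ 2 / (4 * Cmod (C_derive g z) ^ 2))
    (plus (scal (d1 h z) (D1 Y z)) (scal (d2 h z) (D2 Y z))).

Definition eta (z : C) : R3 := plus (grad_L z) (scal (h z) (Y z)).

Definition S_eta (z : C) : R := dot (eta z) (eta z).

End Parametrization.

Record local_parametrization (U : C -> Prop) (c : R) (g : C -> C) (h : C -> R)
  (x n : C -> R3) : Prop := {
  lp_holomorphic : holomorphic_on U g;
  lp_derive_neq0 : forall z, U z -> C_derive g z <> RtoC 0;
  lp_h_smooth : smooth U h;
  lp_h_neq0 : forall z, U z -> h z <> 0;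
  lp_X : forall z, U z ->
    x z = minus (Y g z) (scal (2 * (h z + c) / S_eta g h z) (eta g h z));
  lp_N : forall z, U z ->
    n z = minus (Y g z) (scal (2 * h z / S_eta g h z) (eta g h z))
}.

(* Main.v *)
Require Import Defs.
From Stdlib Require Import Reals Lra.
From Coquelicot Require Import Coquelicot.

Open Scope R_scope.

(* By the parametrization, X + R N = - (c / h) Y with R = - (h + c) / h.
   Differentiating, dX + R dN is - c / h times the reflection in the hyperplane
   orthogonal to eta, applied to dY; hence sigma = (c / h)^2 <dY, dY> is
   conformal to the plane.  On the other hand X - N is - 2 c times the
   inversion of eta, so dX - dN is - 2 c / S times the same reflection applied
   to d eta.  The numbers s_i are the eigenvalues of dX + R dN |-> dX - dN;
   taking the trace, and using that Y is conformal and harmonic as a map to the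
   sphere, gives, with E = 4 |g'|^2 / T^2,
     H_S = h (Delta h + 2 E h) / (S E)  and  <X, N> - 1 = 2 h c / S,
   hence H_S / (<X, N> - 1) = (Delta h + 2 E h) / (2 c E).
   No second derivative of g is needed: Y is smooth because
   (h + c) N - h X = c Y. *)

(** * Partial derivatives *)

(** A Boolean selects the coordinate that moves, [true] being the first, so that each rule for
    partial derivatives is proved once for both. *)
Definition slice (b : bool) (z : C) (t : R) : C :=
  if b then (t, snd z) else (fst z, t).
Definition coord (b : bool) (z : C) : R := if b then fst z else snd z.

(* [pd true] and [pd false] are convertible to [d1] and [d2]. *)
Definition pd (b : bool) (f : C -> R) (z : C) : R :=
  Derive (fun t => f (slice b z t)) (coord b z).
Definition is_pd (b : bool) (f : C -> R) (z : C) (l : R) : Prop :=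
  is_derive (fun t => f (slice b z t)) (coord b z) l.
Definition ex_pd (b : bool) (f : C -> R) (z : C) : Prop :=
  ex_derive (fun t => f (slice b z t)) (coord b z).

Lemma slice_coord b z : slice b z (coord b z) = z.
Proof. now destruct b, z. Qed.

Lemma locally_slice b (P : C -> Prop) z :
  locally z P -> locally (coord b z) (fun t => P (slice b z t)).
Proof.
  intros [eps Heps]; exists eps; intros t Ht; apply Heps.
  destruct b, z; split; try exact Ht; apply ball_center.
Qed.

Lemma is_pd_unique b f z l : is_pd b f z l -> pd b f z = l.
Proof. apply is_derive_unique. Qed.

Lemma ex_pd_correct b f z : ex_pd b f z -> is_pd b f z (pd b f z).
Proof. apply Derive_correct. Qed.

Lemma is_pd_ex b f z l : is_pd b f z l -> ex_pd b f z.
Proof. intros H; exists l; exact H. Qed.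

Section OpenSet.

Context (U : C -> Prop) (U_open : open U).

Lemma is_pd_ext b f f' z l :
  U z -> (forall w, U w -> f w = f' w) -> is_pd b f z l -> is_pd b f' z l.
Proof.
  intros Uz E; apply is_derive_ext_loc.
  apply filter_imp with (2 := locally_slice b U z (U_open z Uz)).
  intros t Ht; apply E, Ht.
Qed.

Lemma ex_pd_ext b f f' z :
  U z -> (forall w, U w -> f w = f' w) -> ex_pd b f z -> ex_pd b f' z.
Proof. intros Uz E [l H]; exists l; exact (is_pd_ext b f f' z l Uz E H). Qed.

Lemma pd_ext b f f' z :
  U z -> (forall w, U w -> f w = f' w) -> pd b f z = pd b f' z.
Proof.
  intros Uz E; apply Derive_ext_loc.
  apply filter_imp with (2 := locally_slice b U z (U_open z Uz)).
  intros t Ht; apply E, Ht.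
Qed.

End OpenSet.

Lemma is_pd_const b (k : R) z : is_pd b (fun _ => k) z 0.
Proof. exact (is_derive_const k _). Qed.

Lemma is_pd_plus b f f' z l l' :
  is_pd b f z l -> is_pd b f' z l' -> is_pd b (fun w => f w + f' w) z (l + l').
Proof. exact (is_derive_plus _ _ _ l l'). Qed.

Lemma is_pd_mult b f f' z l l' :
  is_pd b f z l -> is_pd b f' z l' ->
  is_pd b (fun w => f w * f' w) z (l * f' z + f z * l').
Proof.
  intros H H'.
  generalize (is_derive_mult _ _ _ _ _ H H' Rmult_comm).
  rewrite slice_coord; exact (fun K => K).
Qed.

Lemma is_pd_inv b f z l :
  is_pd b f z l -> f z <> 0 -> is_pd b (fun w => / f w) z (- l / f z ^ 2).
Proof.
  intros H Hf.
  generalize (is_derive_inv _ _ _ H); rewrite slice_coord.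
  exact (fun K => K Hf).
Qed.

(** * Closure properties of the classes C^k and symmetry of second derivatives *)

Lemma class_C_weaken k U f : class_C (S k) U f -> class_C k U f.
Proof.
  revert f; induction k as [|k IH]; intros f [Hc [Hd [H1 H2]]].
  - now split.
  - split; [exact Hc|]; split; [exact Hd|]; split; now apply IH.
Qed.

(** Agreement on an open set passes to limits and to both partial derivatives, hence through the
    recursion. *)
Lemma class_C_ext k U f f' : open U ->
  (forall z, U z -> f z = f' z) -> class_C k U f -> class_C k U f'.
Proof.
  intros HU; revert f f'; induction k as [|k IH]; intros f f' E [Hc H]; split.
  1, 3: intros z Uz; apply continuous_ext_loc with (2 := Hc z Uz);
    apply filter_imp with (2 := HU z Uz); intros; now apply E.
  - trivial.
  - destruct H as [Hd [H1 H2]]; split; [|split].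
    + intros z Uz; split.
      * exact (ex_pd_ext U HU true f f' z Uz E (proj1 (Hd z Uz))).
      * exact (ex_pd_ext U HU false f f' z Uz E (proj2 (Hd z Uz))).
    + apply IH with (2 := H1); intros z Uz; exact (pd_ext U HU true f f' z Uz E).
    + apply IH with (2 := H2); intros z Uz; exact (pd_ext U HU false f f' z Uz E).
Qed.

Lemma class_C_ex_pd k U f b z : class_C (S k) U f -> U z -> ex_pd b f z.
Proof. intros [_ [H _]] Uz; destruct b; apply H, Uz. Qed.

Lemma class_C_pd k U f b : class_C (S k) U f -> class_C k U (pd b f).
Proof. intros [_ [_ [H1 H2]]]; destruct b; assumption. Qed.

Lemma class_C_S k U f :
  (forall z, U z -> continuous f z) ->
  (forall b z, U z -> ex_pd b f z) ->
  (forall b, class_C k U (pd b f)) -> class_C (S k) U f.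
Proof.
  intros Hc Hd H; split; [exact Hc|]; split; [|split].
  - intros z Uz; split; [exact (Hd true z Uz) | exact (Hd false z Uz)].
  - exact (H true).
  - exact (H false).
Qed.

Lemma class_C_continuous k U f z : class_C k U f -> U z -> continuous f z.
Proof. destruct k; intros [H _]; apply H. Qed.

Lemma class_C_const k U (r : R) : open U -> class_C k U (fun _ => r).
Proof.
  intros HU; revert r; induction k as [|k IH]; intros r.
  - split; [intros; apply continuous_const|trivial].
  - apply class_C_S.
    + intros; apply continuous_const.
    + intros b z _; exact (is_pd_ex _ _ _ _ (is_pd_const b r z)).
    + intros b; apply class_C_ext with (3 := IH 0); [exact HU|].
      intros z _; symmetry; apply is_pd_unique, is_pd_const.
Qed.

Lemma class_C_plus k U f f' : open U ->
  class_C k U f -> class_C k U f' -> class_C k U (fun z => f z + f' z).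
Proof.
  intros HU; revert f f'; induction k as [|k IH]; intros f f' H H'.
  - split; [|trivial]; intros z Uz.
    apply (continuous_plus (V := R_NormedModule));
      [now apply (proj1 H) | now apply (proj1 H')].
  - pose proof (fun b z Uz => ex_pd_correct b f z (class_C_ex_pd k U f b z H Uz)) as D.
    pose proof (fun b z Uz => ex_pd_correct b f' z (class_C_ex_pd k U f' b z H' Uz)) as D'.
    apply class_C_S.
    + intros z Uz; apply (continuous_plus (V := R_NormedModule));
        [now apply (proj1 H) | now apply (proj1 H')].
    + intros b z Uz; eapply is_pd_ex, is_pd_plus; auto.
    + intros b; eapply class_C_ext; [exact HU| |
        exact (IH _ _ (class_C_pd k U f b H) (class_C_pd k U f' b H'))].
      intros z Uz; symmetry; apply is_pd_unique, is_pd_plus; auto.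
Qed.

Lemma class_C_mult k U f f' : open U ->
  class_C k U f -> class_C k U f' -> class_C k U (fun z => f z * f' z).
Proof.
  intros HU; revert f f'; induction k as [|k IH]; intros f f' H H'.
  - split; [|trivial]; intros z Uz.
    apply (continuous_mult (K := R_AbsRing));
      [now apply (proj1 H) | now apply (proj1 H')].
  - pose proof (fun b z Uz => ex_pd_correct b f z (class_C_ex_pd k U f b z H Uz)) as D.
    pose proof (fun b z Uz => ex_pd_correct b f' z (class_C_ex_pd k U f' b z H' Uz)) as D'.
    apply class_C_S.
    + intros z Uz; apply (continuous_mult (K := R_AbsRing));
        [now apply (proj1 H) | now apply (proj1 H')].
    + intros b z Uz; eapply is_pd_ex, is_pd_mult; auto.
    + intros b; eapply class_C_ext; [exact HU| |
        exact (class_C_plus k U _ _ HU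
          (IH _ _ (class_C_pd k U f b H) (class_C_weaken k U f' H'))
          (IH _ _ (class_C_weaken k U f H) (class_C_pd k U f' b H')))].
      intros z Uz; symmetry; apply is_pd_unique, is_pd_mult; auto.
Qed.

Lemma pd_comm U f z : open U -> class_C 2 U f -> U z ->
  pd true (pd false f) z = pd false (pd true f) z.
Proof.
  intros HU H Uz; destruct z as [x y].
  apply (Schwarz (fun u v => f (u, v)) x y).
  - apply locally_2d_locally.
    apply filter_imp with (2 := HU _ Uz); intros w Uw.
    repeat split.
    + exact (class_C_ex_pd 1 U f true w H Uw).
    + exact (class_C_ex_pd 1 U f false w H Uw).
    + exact (class_C_ex_pd 0 U _ true w (class_C_pd 1 U f false H) Uw).
    + exact (class_C_ex_pd 0 U _ false w (class_C_pd 1 U f true H) Uw).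
  - apply continuity_2d_pt_filterlim.
    exact (class_C_continuous 0 U _ _
      (class_C_pd 0 U _ true (class_C_pd 1 U f false H)) Uz).
  - apply continuity_2d_pt_filterlim.
    exact (class_C_continuous 0 U _ _
      (class_C_pd 0 U _ false (class_C_pd 1 U f true H)) Uz).
Qed.

(** * Maps to space *)

(** Differentiation rules are first combined into a derivative of some raw shape; this adjusts both
    the function and the value to the wanted form. *)
Lemma is_pd_eq b f f' z l l' : is_pd b f z l ->
  (forall w, f w = f' w) -> l = l' -> is_pd b f' z l'.
Proof. intros H E <-; revert H; apply is_derive_ext; intros t; apply E. Qed.

Lemma dot_sym x y : dot x y = dot y x.
Proof. unfold dot; ring. Qed.

(** [PD true] and [PD false] are convertible to [D1] and [D2], which the [change] steps below
    exploit. *)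
Definition PD (b : bool) (F : C -> R3) (z : C) : R3 :=
  (pd b (fun w => fst (fst (F w))) z, pd b (fun w => snd (fst (F w))) z,
   pd b (fun w => snd (F w)) z).

(* Vector-valued maps are handled through their pairings with constant vectors. *)
Definition ex_pd3 (b : bool) (F : C -> R3) (z : C) : Prop :=
  forall v, ex_pd b (fun w => dot (F w) v) z.

Definition class_C3 (k : nat) (U : C -> Prop) (F : C -> R3) : Prop :=
  forall v, class_C k U (fun w => dot (F w) v).

(** Pairing with the three standard basis vectors recovers the components. *)
Lemma ex_pd3_components b F z : ex_pd3 b F z ->
  is_pd b (fun w => fst (fst (F w))) z (fst (fst (PD b F z))) /\
  is_pd b (fun w => snd (fst (F w))) z (snd (fst (PD b F z))) /\
  is_pd b (fun w => snd (F w)) z (snd (PD b F z)).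
Proof.
  intros H.
  assert (K : forall v f, (forall w, dot (F w) v = f w) -> is_pd b f z (pd b f z)).
  { intros v f E; apply ex_pd_correct; destruct (H v) as [l Hl].
    exists l; exact (is_pd_eq _ _ _ _ _ _ Hl E eq_refl). }
  split; [|split].
  - apply (K (1, 0, 0)); intros; unfold dot; cbn [fst snd]; ring.
  - apply (K (0, 1, 0)); intros; unfold dot; cbn [fst snd]; ring.
  - apply (K (0, 0, 1)); intros; unfold dot; cbn [fst snd]; ring.
Qed.

Lemma is_pd_dot b F G z : ex_pd3 b F z -> ex_pd3 b G z ->
  is_pd b (fun w => dot (F w) (G w)) z (dot (PD b F z) (G z) + dot (F z) (PD b G z)).
Proof.
  intros HF HG.
  destruct (ex_pd3_components b F z HF) as [F1 [F2 F3]].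
  destruct (ex_pd3_components b G z HG) as [G1 [G2 G3]].
  generalize (is_pd_plus _ _ _ _ _ _ (is_pd_plus _ _ _ _ _ _
    (is_pd_mult _ _ _ _ _ _ F1 G1) (is_pd_mult _ _ _ _ _ _ F2 G2))
    (is_pd_mult _ _ _ _ _ _ F3 G3)).
  intros K; apply (is_pd_eq _ _ _ _ _ _ K); [reflexivity|]; unfold dot; ring.
Qed.

Lemma ex_pd3_const b (v : R3) z : ex_pd3 b (fun _ => v) z.
Proof. intros u; eapply is_pd_ex, is_pd_const. Qed.

Lemma PD_const b (v : R3) z : PD b (fun _ => v) z = (0, 0, 0).
Proof. unfold PD; f_equal; [f_equal|]; apply is_pd_unique, is_pd_const. Qed.

Lemma is_pd_dot_const b F z v : ex_pd3 b F z ->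
  is_pd b (fun w => dot (F w) v) z (dot (PD b F z) v).
Proof.
  intros H; generalize (is_pd_dot b F (fun _ => v) z H (ex_pd3_const b v z)).
  rewrite PD_const; intros K; apply (is_pd_eq _ _ _ _ _ _ K); [reflexivity|]; unfold dot; cbn [fst snd]; ring.
Qed.

Lemma smooth3_class_C3 k U F : open U -> smooth3 U F -> class_C3 k U F.
Proof.
  intros HU [H1 [H2 H3]] v; unfold dot.
  repeat apply class_C_plus; trivial; apply class_C_mult; trivial;
    apply class_C_const || apply H1 || apply H2 || apply H3; trivial.
Qed.

Lemma class_C3_ex_pd3 k U F b z : class_C3 (S k) U F -> U z -> ex_pd3 b F z.
Proof. intros H Uz v; exact (class_C_ex_pd k U _ b z (H v) Uz). Qed.

Lemma class_C3_PD k U F b : open U -> class_C3 (S k) U F -> class_C3 k U (PD b F).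
Proof.
  intros HU H v; apply class_C_ext with (3 := class_C_pd k U _ b (H v)); trivial.
  intros z Uz; apply is_pd_unique, is_pd_dot_const.
  exact (class_C3_ex_pd3 k U F b z H Uz).
Qed.

Lemma PD_comm U F z v : open U -> class_C3 2 U F -> U z ->
  dot (PD true (PD false F) z) v = dot (PD false (PD true F) z) v.
Proof.
  intros HU H Uz.
  assert (K : forall b b', pd b (pd b' (fun w => dot (F w) v)) z
                           = dot (PD b (PD b' F) z) v).
  { intros b b'.
    rewrite <- (is_pd_unique _ _ _ _ (is_pd_dot_const b (PD b' F) z v
      (class_C3_ex_pd3 0 U _ b z (class_C3_PD 1 U F b' HU H) Uz))).
    apply (pd_ext U HU); [exact Uz|]; intros w Uw.
    apply is_pd_unique, is_pd_dot_const, (class_C3_ex_pd3 1 U F b' w H Uw). }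
  rewrite <- !K; exact (pd_comm U _ z HU (H v) Uz).
Qed.

Lemma dot_differential F z v u :
  dot (Defs.differential F z v) u = fst v * dot (PD true F z) u + snd v * dot (PD false F z) u.
Proof.
  change (D1 F z) with (PD true F z); change (D2 F z) with (PD false F z).
  unfold Defs.differential; change (D1 F z) with (PD true F z);
  change (D2 F z) with (PD false F z).
  destruct (PD true F z) as [[a1 a2] a3], (PD false F z) as [[b1 b2] b3].
  unfold dot; cbn; ring.
Qed.

Lemma dot_minus_scal (x y v : R3) (k : R) :
  dot (minus x (scal k y)) v = dot x v - k * dot y v.
Proof.
  destruct x as [[x1 x2] x3], y as [[y1 y2] y3], v as [[v1 v2] v3].
  unfold dot; cbn; ring.
Qed.

Lemma dot_eta g h z v :
  dot (eta g h z) v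
  = T g z ^ 2 / (4 * Cmod (C_derive g z) ^ 2)
    * (pd true h z * dot (PD true (Y g) z) v + pd false h z * dot (PD false (Y g) z) v)
    + h z * dot (Y g z) v.
Proof.
  unfold eta, grad_L.
  change (D1 (Y g) z) with (PD true (Y g) z).
  change (D2 (Y g) z) with (PD false (Y g) z).
  change (Defs.d1 h z) with (pd true h z); change (Defs.d2 h z) with (pd false h z).
  destruct (PD true (Y g) z) as [[a1 a2] a3], (PD false (Y g) z) as [[b1 b2] b3],
    (Y g z) as [[y1 y2] y3].
  set (k := T g z ^ 2 / _); unfold dot; cbn; ring.
Qed.

(** * The map Y into the sphere and its conformality *)

Definition direction (b : bool) : C := if b then RtoC 1 else Ci.

(** The complex increment along a slice is [direction b] times a real number, so the partial
    derivatives of g are g' and i g', which encodes the Cauchy-Riemann equations. The real and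
    imaginary parts of the remainder are bounded by its modulus. *)
Lemma holomorphic_is_pd (g : C -> C) z b :
  ex_derive (K := C_AbsRing) (V := C_NormedModule) g z ->
  is_pd b (fun w => Re (g w)) z (Re (C_derive g z * direction b)%C) /\
  is_pd b (fun w => Im (g w)) z (Im (C_derive g z * direction b)%C).
Proof.
  intros H; destruct (C_derive_correct g z z H) as [_ D].
  specialize (D z (fun P HP => HP)).
  set (l := C_derive g z) in *.
  assert (E : forall eps : posreal, locally (coord b z) (fun t =>
    Cmod (g (slice b z t) - g z - l * direction b * RtoC (t - coord b z))%C
      <= eps * Rabs (t - coord b z))).
  { intros eps; destruct (D eps) as [d Hd]; exists d; intros t Ht.
    assert (Es : (slice b z t - z = direction b * RtoC (t - coord b z))%C).
    { destruct z as [z1 z2], b; cbn; unfold RtoC, Ci, Cminus, Cplus, Copp, Cmult;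
        cbn; f_equal; ring. }
    assert (En : Cmod (slice b z t - z)%C = Rabs (t - coord b z)).
    { rewrite Es, Cmod_mult, Cmod_R.
      replace (Cmod (direction b)) with 1; [ring|].
      destruct b; [symmetry; apply Cmod_1|].
      unfold Cmod; cbn; rewrite <- sqrt_1 at 1; f_equal; ring. }
    specialize (Hd (slice b z t)).
    rewrite <- En; eapply Rle_trans; [right | apply Hd].
    - change (Cmod (g (slice b z t) - g z - l * direction b * (t - coord b z)%R)%C
        = Cmod (g (slice b z t) - g z - (slice b z t - z) * l)%C).
      rewrite Es; f_equal; ring.
    - change (Cmod (slice b z t - z)%C < d); rewrite En; exact Ht. }
  split; (split; [apply is_linear_scal_l|]); intros x Hx eps;
    rewrite <- (is_filter_lim_locally_unique _ _ Hx);
    (apply filter_imp with (2 := E eps)); intros t Ht;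
    (eapply Rle_trans; [|exact Ht]); rewrite slice_coord.
  - eapply Rle_trans; [right|apply re_le_Cmod].
    destruct (g (slice b z t)) as [a1 a2], (g z) as [b1 b2],
      (l * direction b)%C as [c1 c2]; unfold norm; cbn.
    apply f_equal; unfold minus, plus, opp, scal; cbn; unfold mult; cbn; ring.
  - eapply Rle_trans; [right|apply (Rle_trans _ _ _ (Rmax_r _ _) (Rmax_Cmod _))].
    destruct (g (slice b z t)) as [a1 a2], (g z) as [b1 b2],
      (l * direction b)%C as [c1 c2]; unfold norm; cbn.
    apply f_equal; unfold minus, plus, opp, scal; cbn; unfold mult; cbn; ring.
Qed.

Lemma Cmod_sq (z : C) : Cmod z ^ 2 = Re z ^ 2 + Im z ^ 2.
Proof. unfold Cmod; rewrite pow2_sqrt; [reflexivity|]; unfold Re, Im; nra. Qed.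

Lemma T_pos g z : 0 < T g z.
Proof. unfold T; generalize (pow2_ge_0 (Cmod (g z))); lra. Qed.

Lemma dot_Y_Y g z : dot (Y g z) (Y g z) = 1.
Proof.
  unfold dot, Y; cbn [fst snd].
  replace (2 - T g z) with (1 - (Re (g z) ^ 2 + Im (g z) ^ 2))
    by (unfold T; rewrite Cmod_sq; ring).
  replace (T g z) with (1 + (Re (g z) ^ 2 + Im (g z) ^ 2))
    by (unfold T; rewrite Cmod_sq; ring).
  field; nra.
Qed.

Lemma is_pd_Y g z b p q :
  is_pd b (fun w => Re (g w)) z p -> is_pd b (fun w => Im (g w)) z q ->
  let t := 2 * (Re (g z) * p + Im (g z) * q) in
  PD b (Y g) z = ((2 * p * T g z - 2 * Re (g z) * t) / T g z ^ 2,
    (2 * q * T g z - 2 * Im (g z) * t) / T g z ^ 2, - 2 * t / T g z ^ 2).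
Proof.
  intros Hp Hq t.
  assert (HT : is_pd b (fun w => / T g w) z (- t / T g z ^ 2)).
  { apply is_pd_inv; [|generalize (T_pos g z); lra].
    generalize (is_pd_plus _ _ _ _ _ _ (is_pd_const b 1 z)
      (is_pd_plus _ _ _ _ _ _ (is_pd_mult _ _ _ _ _ _ Hp Hp)
        (is_pd_mult _ _ _ _ _ _ Hq Hq))).
    intros K; apply (is_pd_eq _ _ _ _ _ _ K).
    - intros w; unfold T; rewrite Cmod_sq; ring.
    - unfold t; ring. }
  pose proof (T_pos g z) as Tp.
  unfold PD, Y; cbn [fst snd]; f_equal; [f_equal|]; apply is_pd_unique.
  - generalize (is_pd_mult _ _ _ _ _ _ (is_pd_mult _ _ _ _ _ _ (is_pd_const b 2 z) Hp) HT).
    intros K; apply (is_pd_eq _ _ _ _ _ _ K); [reflexivity|]; field; lra.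
  - generalize (is_pd_mult _ _ _ _ _ _ (is_pd_mult _ _ _ _ _ _ (is_pd_const b 2 z) Hq) HT).
    intros K; apply (is_pd_eq _ _ _ _ _ _ K); [reflexivity|]; field; lra.
  (* The third component (2 - T) / T is differentiated as 2 / T - 1. *)
  - generalize (is_pd_plus _ _ _ _ _ _
      (is_pd_mult _ _ _ _ _ _ (is_pd_const b 2 z) HT) (is_pd_const b (-1) z)).
    intros K; apply (is_pd_eq _ _ _ _ _ _ K).
    + intros w; generalize (T_pos g w); intros; field; lra.
    + field; lra.
Qed.

(** The conformal factor of the metric induced by Y, written E in the overview. *)
Definition conf (g : C -> C) (z : C) : R := 4 * Cmod (C_derive g z) ^ 2 / T g z ^ 2.

(** Substituting g' and i g' for the partial derivatives of g turns all three identities into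
    rational identities in the real and imaginary parts of g and g'. *)
Lemma Y_conformal g z :
  ex_derive (K := C_AbsRing) (V := C_NormedModule) g z ->
  dot (PD true (Y g) z) (PD true (Y g) z) = conf g z /\
  dot (PD false (Y g) z) (PD false (Y g) z) = conf g z /\
  dot (PD true (Y g) z) (PD false (Y g) z) = 0.
Proof.
  intros H.
  destruct (holomorphic_is_pd g z true H) as [A1 A2].
  destruct (holomorphic_is_pd g z false H) as [B1 B2].
  rewrite (is_pd_Y g z true _ _ A1 A2), (is_pd_Y g z false _ _ B1 B2).
  unfold conf; rewrite Cmod_sq.
  generalize (T_pos g z); unfold T; rewrite Cmod_sq.
  destruct (C_derive g z) as [p q], (g z) as [u v].
  unfold dot; cbn; intros Tp; repeat split; field; nra.
Qed.

(** * The surface and the sphere congruence *)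

(** The vector x + r y, spelled out with real operations so that pairings expand directly by
    [ring]. *)
Definition axpy (x : R3) (r : R) (y : R3) : R3 :=
  (fst (fst x) + r * fst (fst y), snd (fst x) + r * snd (fst y), snd x + r * snd y).

Lemma dot_axpy x r y v : dot (axpy x r y) v = dot x v + r * dot y v.
Proof. unfold dot, axpy; cbn [fst snd]; ring. Qed.

(* With [P], [Q] the partial derivatives of X, N, the vectors (v1, v2) and
   (w1, w2) are eigenvectors of -dN.  They are then eigenvectors of the operator
   sending dX + r dN to dX - dN, whose trace is computed in the orthogonal frame
   [A1], [A2]. *)
Lemma trace_from_eigenvectors (P1 P2 Q1 Q2 : R3) (r q k l v1 v2 w1 w2 : R) :
  let A1 := axpy P1 r Q1 in
  let A2 := axpy P2 r Q2 in
  0 < q -> dot A1 A1 = q -> dot A2 A2 = q -> dot A1 A2 = 0 ->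
  v1 * w2 - v2 * w1 <> 0 ->
  (forall u, - (v1 * dot Q1 u + v2 * dot Q2 u) = k * (v1 * dot P1 u + v2 * dot P2 u)) ->
  (forall u, - (w1 * dot Q1 u + w2 * dot Q2 u) = l * (w1 * dot P1 u + w2 * dot P2 u)) ->
  (1 + k) / (1 - k * r) + (1 + l) / (1 - l * r)
  = (dot (axpy P1 (-1) Q1) A1 + dot (axpy P2 (-1) Q2) A2) / q.
Proof.
  intros A1 A2 Hq H11 H22 H12 D Hv Hw.
  assert (H21 : dot A2 A1 = 0) by (rewrite dot_sym; exact H12).
  (* An eigenvector of -dN for k is one of the second operator for s = (1 + k) / (1 - k r); this is
     tested against the frame [A1], [A2]. *)
  assert (K : forall k v1 v2,
    (forall u, - (v1 * dot Q1 u + v2 * dot Q2 u) = k * (v1 * dot P1 u + v2 * dot P2 u)) ->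
    ~ (v1 = 0 /\ v2 = 0) ->
    let s := (1 + k) / (1 - k * r) in
    v1 * dot (axpy P1 (-1) Q1) A1 + v2 * dot (axpy P2 (-1) Q2) A1 = s * q * v1 /\
    v1 * dot (axpy P1 (-1) Q1) A2 + v2 * dot (axpy P2 (-1) Q2) A2 = s * q * v2).
  { clear - H11 H22 H12 H21 Hq; intros k v1 v2 H V s.
    pose proof (H A1) as E1; pose proof (H A2) as E2.
    unfold A1 at 1 in H11; unfold A1 at 1 in H12; unfold A2 at 1 in H22;
      unfold A2 at 1 in H21.
    rewrite dot_axpy in *.
    set (p1 := v1 * dot P1 A1 + v2 * dot P2 A1) in *.
    set (p2 := v1 * dot P1 A2 + v2 * dot P2 A2) in *.
    assert (F1 : (1 - k * r) * p1 = q * v1).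
    { replace ((1 - k * r) * p1) with (p1 - r * (k * p1)) by ring.
      rewrite <- E1; unfold p1; rewrite <- H11.
      transitivity (v1 * (dot P1 A1 + r * dot Q1 A1) + v2 * (dot P2 A1 + r * dot Q2 A1));
        [ring|rewrite H21; ring]. }
    assert (F2 : (1 - k * r) * p2 = q * v2).
    { replace ((1 - k * r) * p2) with (p2 - r * (k * p2)) by ring.
      rewrite <- E2; unfold p2; rewrite <- H22.
      transitivity (v1 * (dot P1 A2 + r * dot Q1 A2) + v2 * (dot P2 A2 + r * dot Q2 A2));
        [ring|rewrite H12; ring]. }
    (* If 1 - k r vanished, [F1] and [F2] would force the eigenvector to be zero: the denominators
       of the s_i are nonzero because the frame is nondegenerate. *)
    assert (N : 1 - k * r <> 0).
    { intros Z; rewrite Z in F1, F2; apply V; split; nra. }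
    rewrite !dot_axpy; split.
    - transitivity (p1 + k * p1); [rewrite <- E1; unfold p1; ring|].
      unfold s; replace ((1 + k) / (1 - k * r) * q * v1)
        with ((1 + k) / (1 - k * r) * (q * v1)) by ring.
      rewrite <- F1; field; exact N.
    - transitivity (p2 + k * p2); [rewrite <- E2; unfold p2; ring|].
      unfold s; replace ((1 + k) / (1 - k * r) * q * v2)
        with ((1 + k) / (1 - k * r) * (q * v2)) by ring.
      rewrite <- F2; field; exact N. }
  destruct (K k v1 v2 Hv) as [V1 V2]; [intros [-> ->]; apply D; ring|].
  destruct (K l w1 w2 Hw) as [W1 W2]; [intros [-> ->]; apply D; ring|].
  set (s := (1 + k) / (1 - k * r)) in *; set (t := (1 + l) / (1 - l * r)) in *.
  set (b11 := dot (axpy P1 _ _) A1) in *; set (b22 := dot (axpy P2 _ _) A2) in *.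
  set (b12 := dot (axpy P1 _ _) A2) in *; set (b21 := dot (axpy P2 _ _) A1) in *.
  (* For a plane operator B, tr B det(v, w) = det(Bv, w) + det(v, Bw); the right side is the middle
     term below, up to the factor q. *)
  apply (Rmult_eq_reg_r (q * (v1 * w2 - v2 * w1))); [|apply Rmult_integral_contrapositive; lra].
  transitivity ((v1 * b11 + v2 * b21) * w2 - (v1 * b12 + v2 * b22) * w1
    + v1 * (w1 * b12 + w2 * b22) - v2 * (w1 * b11 + w2 * b21)).
  - rewrite V1, V2, W1, W2; ring.
  - field; lra.
Qed.

(** * Computations with Y, eta, X and N in one parametrization *)

Section Parametrized.

Context (U : C -> Prop) (U_open : open U) (c : R) (c_neq0 : c <> 0).
Context (g : C -> C) (h : C -> R) (x n : C -> R3).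
Context (x_smooth : smooth3 U x) (n_smooth : smooth3 U n).
Context (param : local_parametrization U c g h x n).

Lemma conf_pos z : U z -> 0 < conf g z.
Proof.
  intros Uz; unfold conf.
  apply Rdiv_lt_0_compat; [|apply pow_lt, T_pos].
  apply Rmult_lt_0_compat; [lra|]; apply pow_lt, Cmod_gt_0.
  exact (lp_derive_neq0 _ _ _ _ _ _ param z Uz).
Qed.

Lemma h_ex_pd b z : U z -> ex_pd b h z.
Proof. exact (class_C_ex_pd 0 U h b z (lp_h_smooth _ _ _ _ _ _ param 1%nat)). Qed.

(** Both eta terms carry the coefficient 2 h (h + c) / S, with opposite signs, and cancel. *)
Lemma Y_from_X_N z v : U z ->
  (h z + c) * dot (n z) v - h z * dot (x z) v = c * dot (Y g z) v.
Proof.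
  intros Uz; rewrite (lp_X _ _ _ _ _ _ param z Uz), (lp_N _ _ _ _ _ _ param z Uz).
  rewrite !dot_minus_scal; unfold Rdiv; ring.
Qed.

Lemma Y_class_C3 k : class_C3 k U (Y g).
Proof.
  intros v.
  apply class_C_ext with (f := fun z => / c * ((h z + c) * dot (n z) v
    + (-1) * (h z * dot (x z) v))); trivial.
  - intros z Uz; generalize (Y_from_X_N z v Uz); intros E.
    replace (_ + _) with (c * dot (Y g z) v) by (rewrite <- E; ring).
    field; exact c_neq0.
  - pose proof (lp_h_smooth _ _ _ _ _ _ param k).
    pose proof (smooth3_class_C3 k U x U_open x_smooth v).
    pose proof (smooth3_class_C3 k U n U_open n_smooth v).
    apply class_C_mult; [|apply class_C_const|]; trivial.
    apply class_C_plus; [|apply class_C_mult|]; trivial.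
    + apply class_C_plus; trivial; apply class_C_const; trivial.
    + apply class_C_mult; [|apply class_C_const|apply class_C_mult]; trivial.
Qed.

Lemma Y_ex_pd3 b z : U z -> ex_pd3 b (Y g) z.
Proof. exact (class_C3_ex_pd3 0 U _ b z (Y_class_C3 1)). Qed.

Lemma PD_Y_ex_pd3 b b' z : U z -> ex_pd3 b (PD b' (Y g)) z.
Proof. exact (class_C3_ex_pd3 0 U _ b z (class_C3_PD 1 U _ b' U_open (Y_class_C3 2))). Qed.

Lemma dot_Y_PD_Y b z : U z -> dot (Y g z) (PD b (Y g) z) = 0.
Proof.
  intros Uz; pose proof (is_pd_unique _ _ _ _
    (is_pd_dot b _ _ z (Y_ex_pd3 b z Uz) (Y_ex_pd3 b z Uz))) as E.
  rewrite (dot_sym (PD b (Y g) z)) in E.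
  rewrite (is_pd_unique b _ z 0) in E; [lra|].
  apply (is_pd_eq _ _ _ _ _ _ (is_pd_const b 1 z)); [|reflexivity].
  intros w; symmetry; apply dot_Y_Y.
Qed.

Lemma dot_PD_Y z b b' : U z ->
  dot (PD b (Y g) z) (PD b' (Y g) z) = if Bool.eqb b b' then conf g z else 0.
Proof.
  intros Uz.
  destruct (Y_conformal g z (lp_holomorphic _ _ _ _ _ _ param z Uz)) as [E1 [E2 E3]].
  destruct b, b'; cbn; trivial; rewrite dot_sym; trivial.
Qed.

Lemma dot_eta_conf z v : U z ->
  dot (eta g h z) v
  = / conf g z * (pd true h z * dot (PD true (Y g) z) v
                  + pd false h z * dot (PD false (Y g) z) v)
    + h z * dot (Y g z) v.
Proof.
  intros Uz; rewrite dot_eta; f_equal; f_equal; unfold conf.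
  pose proof (T_pos g z).
  pose proof (proj1 (Cmod_gt_0 _) (lp_derive_neq0 _ _ _ _ _ _ param z Uz)).
  field; split; lra.
Qed.

Lemma dot_eta_Y z : U z -> dot (eta g h z) (Y g z) = h z.
Proof.
  intros Uz; rewrite dot_eta_conf by trivial.
  rewrite !(dot_sym (PD _ _ _)), !dot_Y_PD_Y, dot_Y_Y by trivial; ring.
Qed.

(** The tangential part of eta is the gradient of h for the metric induced by Y, and the normal part
    h Y is orthogonal to the derivatives of Y. *)
Lemma dot_eta_PD_Y b z : U z -> dot (eta g h z) (PD b (Y g) z) = pd b h z.
Proof.
  intros Uz; pose proof (conf_pos z Uz); rewrite dot_eta_conf by trivial.
  rewrite !dot_PD_Y, dot_Y_PD_Y by trivial.
  destruct b; cbn; field; lra.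
Qed.

(** S equals (h_1^2 + h_2^2) / E + h^2, and h does not vanish. *)
Lemma S_eta_pos z : U z -> 0 < S_eta g h z.
Proof.
  intros Uz; unfold S_eta; rewrite dot_eta_conf by trivial.
  rewrite !(dot_sym _ (eta g h z)), !dot_eta_PD_Y, dot_eta_Y by trivial.
  pose proof (Rinv_0_lt_compat _ (conf_pos z Uz)).
  pose proof (lp_h_neq0 _ _ _ _ _ _ param z Uz); nra.
Qed.

Lemma eta_ex_pd3 b z : U z -> ex_pd3 b (eta g h) z.
Proof.
  intros Uz v.
  (* The factor [conf] is replaced by the squared length of the first derivative of Y, whose
     differentiability follows from the smoothness of Y. *)
  apply ex_pd_ext with (U := U) (f := fun w =>
    / dot (PD true (Y g) w) (PD true (Y g) w)
      * (pd true h w * dot (PD true (Y g) w) v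
         + pd false h w * dot (PD false (Y g) w) v)
    + h w * dot (Y g w) v); trivial.
  - intros w Uw; rewrite dot_eta_conf, dot_PD_Y by trivial; reflexivity.
  - pose proof (lp_h_smooth _ _ _ _ _ _ param 2%nat) as Hh.
    pose proof (fun b' => ex_pd_correct _ _ _
      (class_C_ex_pd 0 U _ b z (class_C_pd 1 U h b' Hh) Uz)) as Dh.
    pose proof (fun b' => ex_pd_correct _ _ _ (PD_Y_ex_pd3 b b' z Uz v)) as DY.
    assert (N : dot (PD true (Y g) z) (PD true (Y g) z) <> 0)
      by (rewrite dot_PD_Y by trivial; generalize (conf_pos z Uz); cbn; lra).
    pose proof (PD_Y_ex_pd3 b true z Uz) as D1.
    exact (is_pd_ex _ _ _ _ (is_pd_plus _ _ _ _ _ _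
      (is_pd_mult _ _ _ _ _ _ (is_pd_inv _ _ _ _ (is_pd_dot _ _ _ _ D1 D1) N)
        (is_pd_plus _ _ _ _ _ _ (is_pd_mult _ _ _ _ _ _ (Dh true) (DY true))
          (is_pd_mult _ _ _ _ _ _ (Dh false) (DY false))))
      (is_pd_mult _ _ _ _ _ _ (ex_pd_correct _ _ _ (h_ex_pd b z Uz))
        (is_pd_dot_const _ _ _ v (Y_ex_pd3 b z Uz))))).
Qed.

(* Y is a conformal harmonic map to the sphere: Delta Y = - 2 conf Y, here
   paired with eta. *)
Lemma dot_eta_laplacian_Y z : U z ->
  dot (eta g h z) (PD true (PD true (Y g)) z)
  + dot (eta g h z) (PD false (PD false (Y g)) z) = - 2 * conf g z * h z.
Proof.
  intros Uz.
  assert (D : forall b b1 b2, pd b (fun w => dot (PD b1 (Y g) w) (PD b2 (Y g) w)) z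
    = dot (PD b (PD b1 (Y g)) z) (PD b2 (Y g) z)
      + dot (PD b1 (Y g) z) (PD b (PD b2 (Y g)) z)).
  { intros; apply is_pd_unique, is_pd_dot; apply PD_Y_ex_pd3; trivial. }
  (* Differentiating the orthogonality of Y and Y_b gives the component of Delta Y along Y. *)
  assert (D0 : forall b, dot (PD b (Y g) z) (PD b (Y g) z)
    + dot (Y g z) (PD b (PD b (Y g)) z) = 0).
  { intros b; rewrite <- (is_pd_unique _ _ _ _ (is_pd_dot b (Y g) (PD b (Y g)) z
      (Y_ex_pd3 b z Uz) (PD_Y_ex_pd3 b b z Uz))).
    rewrite (pd_ext U U_open b _ (fun _ => 0) z Uz); [apply is_pd_unique, is_pd_const|].
    intros; apply dot_Y_PD_Y; trivial. }
  (* Differentiating the two conformality relations, [Eq] and [Ort], and swapping mixed derivatives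
     shows that Delta Y is orthogonal to both Y_1 and Y_2. *)
  assert (Eq : forall b, pd b (fun w => dot (PD true (Y g) w) (PD true (Y g) w)) z
    = pd b (fun w => dot (PD false (Y g) w) (PD false (Y g) w)) z).
  { intros b; apply (pd_ext U U_open); trivial.
    intros; rewrite !dot_PD_Y by trivial; reflexivity. }
  assert (Ort : forall b, pd b (fun w => dot (PD true (Y g) w) (PD false (Y g) w)) z = 0).
  { intros b; rewrite (pd_ext U U_open b _ (fun _ => 0) z Uz);
      [apply is_pd_unique, is_pd_const|].
    intros; rewrite dot_PD_Y by trivial; reflexivity. }
  pose proof (fun v => PD_comm U (Y g) z v U_open (Y_class_C3 2) Uz) as Sw.
  pose proof (Eq true) as Eq1; pose proof (Eq false) as Eq2.
  pose proof (Ort true) as Or1; pose proof (Ort false) as Or2.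
  rewrite !D in *.
  pose proof (D0 true) as Y1; pose proof (D0 false) as Y2.
  rewrite dot_PD_Y in Y1, Y2 by trivial; cbn in Y1, Y2.
  rewrite !dot_eta_conf by trivial.
  rewrite !(dot_sym _ (PD true (PD false (Y g)) z)), !Sw in *.
  rewrite !(dot_sym _ (PD false (PD true (Y g)) z)) in *.
  rewrite !(dot_sym _ (PD true (PD true (Y g)) z)) in *.
  rewrite !(dot_sym _ (PD false (PD false (Y g)) z)) in *.
  match goal with |- ?l = _ => replace l with
    (/ conf g z * (pd true h z *
       (dot (PD true (PD true (Y g)) z) (PD true (Y g) z)
        + dot (PD false (PD false (Y g)) z) (PD true (Y g) z))
     + pd false h z *
       (dot (PD true (PD true (Y g)) z) (PD false (Y g) z)
        + dot (PD false (PD false (Y g)) z) (PD false (Y g) z)))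
     + h z * (dot (PD true (PD true (Y g)) z) (Y g z)
        + dot (PD false (PD false (Y g)) z) (Y g z))) by ring end.
  replace (dot (PD true (PD true (Y g)) z) (PD true (Y g) z)
        + dot (PD false (PD false (Y g)) z) (PD true (Y g) z)) with 0 by lra.
  replace (dot (PD true (PD true (Y g)) z) (PD false (Y g) z)
        + dot (PD false (PD false (Y g)) z) (PD false (Y g) z)) with 0 by lra.
  replace (dot (PD true (PD true (Y g)) z) (Y g z)
        + dot (PD false (PD false (Y g)) z) (Y g z)) with (- 2 * conf g z) by lra.
  ring.
Qed.

(** Differentiate the identity of [dot_eta_PD_Y] in the same direction b and sum: the term with
    Delta Y is supplied by harmonicity. *)
Lemma divergence_eta z : U z ->
  dot (PD true (eta g h) z) (PD true (Y g) z)
  + dot (PD false (eta g h) z) (PD false (Y g) z)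
  = laplacian h z + 2 * conf g z * h z.
Proof.
  intros Uz.
  assert (D : forall b, dot (PD b (eta g h) z) (PD b (Y g) z)
    = pd b (pd b h) z - dot (eta g h z) (PD b (PD b (Y g)) z)).
  { intros b; pose proof (is_pd_unique _ _ _ _ (is_pd_dot b (eta g h) (PD b (Y g)) z
      (eta_ex_pd3 b z Uz) (PD_Y_ex_pd3 b b z Uz))) as E.
    rewrite (pd_ext U U_open b _ (pd b h) z Uz) in E; [lra|].
    intros; apply dot_eta_PD_Y; trivial. }
  rewrite !D; pose proof (dot_eta_laplacian_Y z Uz).
  unfold laplacian.
  change (Defs.d1 (Defs.d1 h) z) with (pd true (pd true h) z).
  change (Defs.d2 (Defs.d2 h) z) with (pd false (pd false h) z).
  lra.
Qed.

(** The coefficient is the radius function expressed through h, as [radius_param] establishes. *)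
Definition dX_RdN (b : bool) (z : C) : R3 := axpy (PD b x z) (- (h z + c) / h z) (PD b n z).
Definition dX_dN (b : bool) (z : C) : R3 := axpy (PD b x z) (-1) (PD b n z).

(** S is kept as a factor on the left so that the relation can be differentiated by the product
    rule. *)
Lemma X_minus_N z v : U z ->
  S_eta g h z * (dot (x z) v - dot (n z) v) = - 2 * c * dot (eta g h z) v.
Proof.
  intros Uz; pose proof (S_eta_pos z Uz).
  rewrite (lp_X _ _ _ _ _ _ param z Uz), (lp_N _ _ _ _ _ _ param z Uz).
  rewrite !dot_minus_scal; field; lra.
Qed.

Lemma x_ex_pd3 b z : U z -> ex_pd3 b x z.
Proof. exact (class_C3_ex_pd3 0 U x b z (smooth3_class_C3 1 U x U_open x_smooth)). Qed.

Lemma n_ex_pd3 b z : U z -> ex_pd3 b n z.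
Proof. exact (class_C3_ex_pd3 0 U n b z (smooth3_class_C3 1 U n U_open n_smooth)). Qed.

(** Differentiate (h + c) N - h X = c Y and eliminate X - N in favour of eta. Since h_b is the
    pairing of eta with Y_b, the bracket is the reflection of Y_b in the hyperplane orthogonal to
    eta. *)
Lemma dot_dX_RdN b z v : U z ->
  dot (dX_RdN b z) v
  = - (c / h z) * (dot (PD b (Y g) z) v - 2 * pd b h z / S_eta g h z * dot (eta g h z) v).
Proof.
  intros Uz; pose proof (S_eta_pos z Uz) as HS.
  pose proof (lp_h_neq0 _ _ _ _ _ _ param z Uz) as Hh.
  pose proof (ex_pd_correct b h z (h_ex_pd b z Uz)) as Dh.
  pose proof (is_pd_plus _ _ _ _ _ _
    (is_pd_mult _ _ _ _ _ _ (is_pd_plus _ _ _ _ _ _ Dh (is_pd_const b c z))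
      (is_pd_dot_const b n z v (n_ex_pd3 b z Uz)))
    (is_pd_mult _ _ _ _ _ _ (is_pd_const b (-1) z)
      (is_pd_mult _ _ _ _ _ _ Dh (is_pd_dot_const b x z v (x_ex_pd3 b z Uz))))) as E.
  apply is_pd_unique in E.
  rewrite (pd_ext U U_open b _ (fun w => c * dot (Y g w) v) z Uz) in E
    by (intros w Uw; rewrite <- Y_from_X_N by trivial; ring).
  rewrite (is_pd_unique _ _ _ _ (is_pd_mult _ _ _ _ _ _ (is_pd_const b c z)
    (is_pd_dot_const b (Y g) z v (Y_ex_pd3 b z Uz)))) in E.
  pose proof (X_minus_N z v Uz) as M.
  unfold dX_RdN; rewrite dot_axpy.
  replace (dot (eta g h z) v)
    with (- S_eta g h z * (dot (x z) v - dot (n z) v) / (2 * c))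
    by (apply (Rmult_eq_reg_l (- 2 * c)); [rewrite <- M; field; trivial|lra]).
  apply (Rmult_eq_reg_l (- h z)); [|lra].
  transitivity (- (c * dot (PD b (Y g) z) v
    - pd b h z * (dot (n z) v - dot (x z) v)) * -1).
  - replace (c * dot (PD b (Y g) z) v) with (0 * dot (Y g z) v + c * dot (PD b (Y g) z) v) by ring.
    rewrite E; field; trivial.
  - field; repeat split; lra || trivial.
Qed.

(** Differentiate S (X - N) = - 2 c eta, where S_b is twice the pairing of eta with eta_b. The
    bracket is the same reflection, now applied to eta_b. *)
Lemma dot_dX_dN b z v : U z ->
  dot (dX_dN b z) v
  = - (2 * c / S_eta g h z)
    * (dot (PD b (eta g h) z) v
       - 2 * dot (eta g h z) (PD b (eta g h) z) / S_eta g h z * dot (eta g h z) v).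
Proof.
  intros Uz; pose proof (S_eta_pos z Uz) as HS.
  pose proof (eta_ex_pd3 b z Uz) as De.
  pose proof (is_pd_mult _ _ _ _ _ _ (is_pd_dot _ _ _ _ De De)
    (is_pd_plus _ _ _ _ _ _ (is_pd_dot_const b x z v (x_ex_pd3 b z Uz))
      (is_pd_mult _ _ _ _ _ _ (is_pd_const b (-1) z)
        (is_pd_dot_const b n z v (n_ex_pd3 b z Uz))))) as E.
  apply is_pd_unique in E.
  rewrite (pd_ext U U_open b _ (fun w => - 2 * c * dot (eta g h w) v) z Uz) in E
    by (intros w Uw; rewrite <- X_minus_N by trivial; unfold S_eta; ring).
  rewrite (is_pd_unique _ _ _ _ (is_pd_mult _ _ _ _ _ _ (is_pd_const b (- 2 * c) z)
    (is_pd_dot_const b (eta g h) z v De))) in E.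
  rewrite (dot_sym (PD b (eta g h) z) (eta g h z)) in E.
  pose proof (X_minus_N z v Uz) as M.
  unfold dX_dN; rewrite dot_axpy.
  unfold S_eta in *; set (S := dot (eta g h z) (eta g h z)) in *.
  set (e := dot (eta g h z) (PD b (eta g h) z)) in *.
  apply (Rmult_eq_reg_l (S * S)); [|nra].
  transitivity (S * (- 2 * c * dot (PD b (eta g h) z) v)
    - 2 * e * (S * (dot (x z) v - dot (n z) v))).
  - transitivity (S * (0 * dot (eta g h z) v + - 2 * c * dot (PD b (eta g h) z) v)
      - 2 * e * (S * (dot (x z) v - dot (n z) v))); [rewrite E; ring|ring].
  - rewrite M; field; lra.
Qed.

Lemma dot_dX_RdN_dX_RdN b b' z : U z ->
  dot (dX_RdN b z) (dX_RdN b' z)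
  = (c / h z) ^ 2 * dot (PD b (Y g) z) (PD b' (Y g) z).
Proof.
  intros Uz; pose proof (S_eta_pos z Uz) as HS.
  pose proof (lp_h_neq0 _ _ _ _ _ _ param z Uz) as Hh.
  rewrite dot_dX_RdN, !(dot_sym _ (dX_RdN b' z)), !dot_dX_RdN by trivial.
  rewrite !dot_eta_PD_Y, (dot_sym _ (eta g h z)), dot_eta_PD_Y by trivial.
  rewrite (dot_sym (PD b' _ _)); unfold S_eta in *.
  field; split; lra.
Qed.

(** Both vectors are multiples of images under one reflection, which preserves inner products and so
    drops out. *)
Lemma dot_dX_dN_dX_RdN b b' z : U z ->
  dot (dX_dN b z) (dX_RdN b' z)
  = 2 * c ^ 2 / (S_eta g h z * h z) * dot (PD b (eta g h) z) (PD b' (Y g) z).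
Proof.
  intros Uz; pose proof (S_eta_pos z Uz) as HS.
  pose proof (lp_h_neq0 _ _ _ _ _ _ param z Uz) as Hh.
  rewrite dot_sym, dot_dX_RdN, !(dot_sym _ (dX_dN b z)), !dot_dX_dN by trivial.
  rewrite !dot_eta_PD_Y, (dot_sym (PD b (eta g h) z) (eta g h z)) by trivial.
  unfold S_eta in *; field; split; lra.
Qed.

End Parametrized.

(** * Symmetry of the second form and Laplacians of conformal metrics *)

(** Differentiating the orthogonality of N and X_b' turns each side into minus the pairing of N with
    a mixed second derivative of X. *)
Lemma II_sym U x n z : open U -> smooth3 U x -> smooth3 U n ->
  (forall b w, U w -> dot (n w) (PD b x w) = 0) -> U z ->
  dot (PD true n z) (PD false x z) = dot (PD false n z) (PD true x z).
Proof.
  intros HU Hx Hn O Uz.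
  pose proof (smooth3_class_C3 2 U x HU Hx) as Cx.
  assert (D : forall b b', dot (PD b n z) (PD b' x z)
    = - dot (n z) (PD b (PD b' x) z)).
  { intros b b'.
    pose proof (is_pd_unique _ _ _ _ (is_pd_dot b n (PD b' x) z
      (class_C3_ex_pd3 0 U n b z (smooth3_class_C3 1 U n HU Hn) Uz)
      (class_C3_ex_pd3 0 U _ b z (class_C3_PD 1 U x b' HU Cx) Uz))) as E.
    rewrite (pd_ext U HU b _ (fun _ => 0) z Uz) in E by (intros; apply O; trivial).
    rewrite (is_pd_unique _ _ _ _ (is_pd_const b 0 z)) in E; lra. }
  rewrite !D, (dot_sym _ (PD true _ _)), (PD_comm U x z _ HU Cx Uz).
  rewrite dot_sym; reflexivity.
Qed.

(** In dimension two the area density equals the conformal factor m, so m cancels inside the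
    divergence and survives only as the outer divisor. *)
Lemma laplace_beltrami_conformal U E F G f m z : open U -> U z ->
  (forall w, U w -> 0 < m w /\ E w = m w /\ F w = 0 /\ G w = m w) ->
  laplace_beltrami E F G f z = laplacian f z / m z.
Proof.
  intros HU Uz H; unfold laplace_beltrami, laplacian.
  assert (r : forall w, U w -> sqrt (E w * G w - F w ^ 2) = m w).
  { intros w Uw; destruct (H w Uw) as [Hm [-> [-> ->]]].
    replace (m w * m w - 0 ^ 2) with (m w * m w) by ring; apply sqrt_square; lra. }
  rewrite r by trivial; f_equal; f_equal.
  - apply (pd_ext U HU true); trivial; intros w Uw; rewrite r by trivial.
    destruct (H w Uw) as [Hm [_ [-> ->]]]; field; lra.
  - apply (pd_ext U HU false); trivial; intros w Uw; rewrite r by trivial.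
    destruct (H w Uw) as [Hm [-> [-> _]]]; field; lra.
Qed.

Lemma laplacian_ext U f f' z : open U -> U z -> (forall w, U w -> f w = f' w) ->
  laplacian f z = laplacian f' z.
Proof.
  intros HU Uz E; unfold laplacian; f_equal.
  - apply (pd_ext U HU true); trivial; intros; apply (pd_ext U HU true); trivial.
  - apply (pd_ext U HU false); trivial; intros; apply (pd_ext U HU false); trivial.
Qed.

(** [Derive_scal] holds for the total [Derive], so a constant passes through both nested
    derivatives, default values included. *)
Lemma laplacian_scal k f z : laplacian (fun w => k * f w) z = k * laplacian f z.
Proof.
  assert (D : forall b f z, pd b (fun w => k * f w) z = k * pd b f z)
    by (intros; apply Derive_scal).
  unfold laplacian.
  change (pd true (pd true (fun w => k * f w)) z + pd false (pd false (fun w => k * f w)) z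
    = k * (pd true (pd true f) z + pd false (pd false f) z)).
  rewrite Rmult_plus_distr_l, <- !D; f_equal; apply Derive_ext; intros; apply D.
Qed.

(** * Curvature quantities of the surface in a chart *)

Section Chart.

Context {Sigma : RiemannSurface} (X N : Sigma -> R3) (k1 k2 : Sigma -> R) (c : R).
Context (a : chart Sigma) (g : C -> C) (h : C -> R).
Context (hX : immersion X) (hN : gauss_map X N) (hk : principal_curvatures X N k1 k2).
Context (hc : c <> 0).
Context (param : local_parametrization (dom a) c g h (pull X a) (pull N a)).

Local Notation U := (dom a).
Local Notation x := (pull X a).
Local Notation n := (pull N a).

Let U_open : open U := dom_open Sigma a.
Let x_smooth : smooth3 U x := proj1 (hX a).
Let n_smooth : smooth3 U n := proj1 (hN a).

Lemma X_N_eta z v : U z ->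
  dot (x z) v = dot (Y g z) v - 2 * (h z + c) / S_eta g h z * dot (eta g h z) v /\
  dot (n z) v = dot (Y g z) v - 2 * h z / S_eta g h z * dot (eta g h z) v.
Proof.
  intros Uz; rewrite (lp_X _ _ _ _ _ _ param z Uz), (lp_N _ _ _ _ _ _ param z Uz).
  split; apply dot_minus_scal.
Qed.

(** Expand X and N in Y and eta, using unit length of Y, the pairing h of eta with Y, and S for the
    squared length of eta. *)
Lemma X_N_products z : U z ->
  dot (x z) (n z) - 1 = 2 * h z * c / S_eta g h z /\
  dot (x z) (x z) - 1 = 4 * c * (h z + c) / S_eta g h z.
Proof.
  intros Uz; pose proof (S_eta_pos _ U_open _ hc _ _ _ _ x_smooth n_smooth param z Uz) as HS.
  assert (Yx : forall v, dot (x z) v = _) by (intros v; exact (proj1 (X_N_eta z v Uz))).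
  assert (Yn : forall v, dot (n z) v = _) by (intros v; exact (proj2 (X_N_eta z v Uz))).
  assert (YY := dot_Y_Y g z); assert (eY := dot_eta_Y _ U_open _ hc _ _ _ _ x_smooth n_smooth param z Uz).
  assert (Ye : dot (Y g z) (eta g h z) = h z) by (rewrite dot_sym; exact eY).
  rewrite !Yx, !(dot_sym _ (n z)), !(dot_sym _ (x z)), !Yx, !Yn.
  rewrite eY, Ye, YY; unfold S_eta in *; split; field; lra.
Qed.

Lemma radius_param z : U z -> radius X N (par a z) = - (h z + c) / h z.
Proof.
  intros Uz; pose proof (S_eta_pos _ U_open _ hc _ _ _ _ x_smooth n_smooth param z Uz) as HS.
  pose proof (lp_h_neq0 _ _ _ _ _ _ param z Uz) as Hh.
  destruct (X_N_products z Uz) as [E1 E2].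
  unfold radius, support.
  change (X (par a z)) with (x z); change (N (par a z)) with (n z).
  replace (1 - dot (x z) (x z)) with (- (dot (x z) (x z) - 1)) by ring.
  rewrite E1, E2; field; repeat split; lra.
Qed.

Lemma N_orthogonal b z : U z -> dot (n z) (PD b x z) = 0.
Proof.
  intros Uz; pose proof (proj2 (proj2 (hN a) z Uz)) as O.
  specialize (O (if b then e1 else e2)); rewrite dot_sym, dot_differential in O.
  rewrite dot_sym; revert O; destruct b; cbn [fst snd e1 e2]; lra.
Qed.

Lemma sigma_param z v w : U z ->
  Defs.sigma X N a z v w
  = fst v * fst w * dot (dX_RdN c h x n true z) (dX_RdN c h x n true z)
    + (fst v * snd w + snd v * fst w)
      * dot (dX_RdN c h x n true z) (dX_RdN c h x n false z)
    + snd v * snd w * dot (dX_RdN c h x n false z) (dX_RdN c h x n false z).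
Proof.
  intros Uz; unfold Defs.sigma, first_form, second_form, third_form, dX_RdN.
  replace (pull (radius X N) a z) with (- (h z + c) / h z)
    by (symmetry; exact (radius_param z Uz)).
  set (r := - (h z + c) / h z).
  assert (O : forall y u, dot (opp y) u = - dot y u)
    by (intros [[? ?] ?] [[? ?] ?]; unfold dot; cbn; ring).
  assert (dot_axpy_r : forall u y k y', dot u (axpy y k y') = dot u y + k * dot u y')
    by (intros; unfold dot, axpy; cbn [fst snd]; ring).
  assert (dot_differential_r : forall u F y, dot u (Defs.differential F z y)
    = fst y * dot u (PD true F z) + snd y * dot u (PD false F z))
    by (intros; rewrite dot_sym, dot_differential, !(dot_sym u); reflexivity).
  rewrite O, !dot_axpy, !dot_axpy_r, !dot_differential, !dot_differential_r.
  (* The square of dX + R dN contains dN paired with dX in both orders, while sigma contains twice a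
     single order; symmetry of II identifies them. *)
  pose proof (II_sym U x n z U_open x_smooth n_smooth N_orthogonal Uz) as Sy.
  rewrite !(dot_sym (PD _ x z) (PD _ n z)), (dot_sym (PD false x z) (PD true x z)),
    (dot_sym (PD false n z) (PD true n z)), Sy; ring.
Qed.

Lemma dX_RdN_conformal b b' z : U z ->
  dot (dX_RdN c h x n b z) (dX_RdN c h x n b' z)
  = if Bool.eqb b b' then (c / h z) ^ 2 * conf g z else 0.
Proof.
  intros Uz; rewrite (dot_dX_RdN_dX_RdN U U_open c hc g h x n x_smooth n_smooth param)
    by trivial.
  rewrite (dot_PD_Y U c g h x n param) by trivial.
  destruct (Bool.eqb b b'); ring.
Qed.

Lemma sigma_factor_pos z : U z -> 0 < (c / h z) ^ 2 * conf g z.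
Proof.
  intros Uz; pose proof (conf_pos _ _ _ _ _ _ param z Uz).
  pose proof (lp_h_neq0 _ _ _ _ _ _ param z Uz).
  apply Rmult_lt_0_compat; trivial; apply pow2_gt_0; unfold Rdiv.
  apply Rmult_integral_contrapositive; split; trivial; now apply Rinv_neq_0_compat.
Qed.

(** The trace is taken in the frame [dX_RdN], orthogonal with squared lengths (c / h)^2 E. Its
    diagonal pairings are 2 c^2 / (S h) times those of eta_b with Y_b, which sum to
    [divergence_eta]. *)
Lemma spherical_mean_param z : U z ->
  spherical_mean X N k1 k2 (par a z)
  = h z / (S_eta g h z * conf g z) * (laplacian h z + 2 * conf g z * h z).
Proof.
  intros Uz; pose proof (S_eta_pos _ U_open _ hc _ _ _ _ x_smooth n_smooth param z Uz) as HS.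
  pose proof (lp_h_neq0 _ _ _ _ _ _ param z Uz) as Hh.
  pose proof (conf_pos _ _ _ _ _ _ param z Uz) as Hq.
  destruct (hk a z Uz) as [v [w [D [Hv Hw]]]].
  (* The vector eigenvalue equation is paired with arbitrary u, the form required by
     [trace_from_eigenvectors]. *)
  assert (K : forall k y, opp (Defs.differential n z y) = scal k (Defs.differential x z y) ->
    forall u, - (fst y * dot (PD true n z) u + snd y * dot (PD false n z) u)
      = k * (fst y * dot (PD true x z) u + snd y * dot (PD false x z) u)).
  { intros k y E u; rewrite <- !dot_differential.
    apply (f_equal (fun s => dot s u)) in E; revert E.
    destruct (Defs.differential n z y) as [[? ?] ?], (Defs.differential x z y) as [[? ?] ?].
    unfold dot; cbn; intros E.
    etransitivity; [|etransitivity; [exact E|]]; unfold scal; cbn; unfold mult; cbn; ring. }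
  unfold spherical_mean; rewrite radius_param by trivial.
  rewrite (trace_from_eigenvectors (PD true x z) (PD false x z) (PD true n z)
    (PD false n z) _ ((c / h z) ^ 2 * conf g z) _ _ (fst v) (snd v) (fst w) (snd w));
    [| apply sigma_factor_pos; trivial
     | exact (dX_RdN_conformal true true z Uz)
     | exact (dX_RdN_conformal false false z Uz)
     | exact (dX_RdN_conformal true false z Uz)
     | exact D | exact (K _ _ Hv) | exact (K _ _ Hw)].
  change (axpy (PD ?b x z) (-1) (PD ?b n z)) with (dX_dN x n b z).
  change (axpy (PD ?b x z) _ (PD ?b n z)) with (dX_RdN c h x n b z).
  rewrite !(dot_dX_dN_dX_RdN U U_open c hc g h x n x_smooth n_smooth param) by trivial.
  rewrite <- (divergence_eta U U_open c hc g h x n x_smooth n_smooth param) by trivial.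
  field; repeat split; lra || trivial.
Qed.

(** The factor h / S of the spherical mean also occurs in the support function minus one and
    cancels, leaving an expression linear in h. *)
Lemma quotient_param z : U z ->
  spherical_mean X N k1 k2 (par a z) / (support X N (par a z) - 1)
  = / (2 * c) * (1 / conf g z * (laplacian h z + 2 * conf g z * h z)).
Proof.
  intros Uz; pose proof (S_eta_pos _ U_open _ hc _ _ _ _ x_smooth n_smooth param z Uz) as HS.
  pose proof (lp_h_neq0 _ _ _ _ _ _ param z Uz) as Hh.
  pose proof (conf_pos _ _ _ _ _ _ param z Uz) as Hq.
  rewrite spherical_mean_param by trivial.
  unfold support; change (X (par a z)) with (x z); change (N (par a z)) with (n z).
  rewrite (proj1 (X_N_products z Uz)); field; repeat split; lra || trivial.
Qed.

(** Since sigma is conformal to the plane, its Laplacian is the Euclidean one divided by (c / h)^2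
    E. *)
Lemma H2_operator_param z : U z ->
  laplace_beltrami
    (fun w => Defs.sigma X N a w e1 e1) (fun w => Defs.sigma X N a w e1 e2)
    (fun w => Defs.sigma X N a w e2 e2)
    (pull (fun p => spherical_mean X N k1 k2 p / (support X N p - 1)) a) z
  = / (2 * c) * laplacian (fun w => 1 / conf g w * (laplacian h w + 2 * conf g w * h w)) z
    / ((c / h z) ^ 2 * conf g z).
Proof.
  intros Uz.
  rewrite (laplace_beltrami_conformal U _ _ _ _
    (fun w => (c / h w) ^ 2 * conf g w) z U_open Uz).
  - rewrite <- laplacian_scal; f_equal.
    apply (laplacian_ext U); trivial; intros w Uw; exact (quotient_param w Uw).
  - intros w Uw; split; [apply sigma_factor_pos; trivial|].
    rewrite !sigma_param, !dX_RdN_conformal by trivial.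
    cbn [Bool.eqb e1 e2 fst snd]; repeat split; ring.
Qed.

End Chart.

(** * The two equivalences *)

Lemma conf_8 g z : 8 * Cmod (C_derive g z) ^ 2 / T g z ^ 2 = 2 * conf g z.
Proof. unfold conf, Rdiv; ring. Qed.

Lemma helmholtz_conf g h z :
  laplacian (fun w => 1 / (4 * Cmod (C_derive g w) ^ 2 / T g w ^ 2)
    * (laplacian h w + 8 * Cmod (C_derive g w) ^ 2 / T g w ^ 2 * h w)) z
  = laplacian (fun w => 1 / conf g w * (laplacian h w + 2 * conf g w * h w)) z.
Proof.
  apply (laplacian_ext (fun _ => True)); trivial; [exact open_true|].
  intros w _; rewrite conf_8; reflexivity.
Qed.

Theorem theorem3p3 (Sigma : RiemannSurface) (X N : Sigma -> R3)
  (k1 k2 : Sigma -> R) (c : R)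
  (g : chart Sigma -> C -> C) (h : chart Sigma -> C -> R)
  (hX : immersion X) (hN : gauss_map X N)
  (hk : principal_curvatures X N k1 k2)
  (hPsi : forall p : Sigma, dot (X p) (N p) <> 1)
  (hc : c <> 0)
  (hpar : forall a : chart Sigma,
     local_parametrization (dom a) c (g a) (h a) (pull X a) (pull N a)) :
  (H1_surface X N k1 k2 <->
   forall (a : chart Sigma) (z : C), dom a z ->
     laplacian (h a) z
     + 8 * Cmod (C_derive (g a) z) ^ 2 / T (g a) z ^ 2 * h a z = 0)
  /\
  (H2_surface X N k1 k2 <->
   forall (a : chart Sigma) (z : C), dom a z ->
     laplacian
       (fun w => 1 / (4 * Cmod (C_derive (g a) w) ^ 2 / T (g a) w ^ 2)
                 * (laplacian (h a) w
                    + 8 * Cmod (C_derive (g a) w) ^ 2 / T (g a) w ^ 2 * h a w))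
       z = 0).
Proof.
  split; split.
  - intros H a z Uz; rewrite conf_8.
    pose proof (spherical_mean_param X N k1 k2 c a (g a) (h a) hX hN hk hc (hpar a) z Uz) as E.
    rewrite (H (par a z)) in E; symmetry in E.
    (* The first factor h / (S E) cannot vanish, because h does not. *)
    apply Rmult_integral in E; destruct E as [E|E]; [exfalso|exact E].
    pose proof (S_eta_pos _ (dom_open Sigma a) _ hc _ _ _ _ (proj1 (hX a)) (proj1 (hN a)) (hpar a) z Uz).
    pose proof (conf_pos _ _ _ _ _ _ (hpar a) z Uz).
    apply (lp_h_neq0 _ _ _ _ _ _ (hpar a) z Uz).
    replace (h a z) with (h a z / (S_eta (g a) (h a) z * conf (g a) z)
      * (S_eta (g a) (h a) z * conf (g a) z)) by (field; lra).
    rewrite E; ring.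
  - intros H p; destruct (par_cover Sigma p) as [a [z [Uz <-]]].
    rewrite (spherical_mean_param X N k1 k2 c a (g a) (h a) hX hN hk hc (hpar a) z Uz).
    rewrite <- conf_8, (H a z Uz); ring.
  - intros H a z Uz; specialize (H a z Uz).
    rewrite (H2_operator_param X N k1 k2 c a (g a) (h a) hX hN hk hc (hpar a) z Uz) in H.
    pose proof (sigma_factor_pos X N c a (g a) (h a) hc (hpar a) z Uz) as P.
    rewrite <- helmholtz_conf in H; set (l := laplacian _ z) in *.
    set (q := (c / h a z) ^ 2 * conf (g a) z) in *.
    (* The operator differs from l by the factor 1 / (2 c q), with c nonzero and q positive, so l is
       recovered by multiplying back. *)
    replace l with (/ (2 * c) * l / q * (2 * c * q)) by (field; lra).
    rewrite H; ring.
  - intros H a z Uz; specialize (H a z Uz).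
    rewrite (H2_operator_param X N k1 k2 c a (g a) (h a) hX hN hk hc (hpar a) z Uz).
    rewrite <- helmholtz_conf, H; unfold Rdiv; ring.
Qed.
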